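(* If $R$ is a symmetric binary relation on a set $A$, $R$ contains an odd cycle, and $R$ is compatible with a near unanimity operation on $A$, then $R$ contains a loop, i.e., a pair $(a,a)\in R$.
   Context: The set $A$ may be infinite. An $n$-ary operation $f$ on $A$ with $n>2$ is a near unanimity operation if $f(x,\dots,x,y,x,\dots,x)=x$ for any $x,y\in A$ and any position of $y$ in the $n$-tuple of arguments. $R\subseteq A^2$ is compatible with $f$ if applying $f$ coordinate-wise to any $n$ pairs in $R$ gives a pair in $R$. A cycle of length $k$ in $R$ is a tuple $(a_1,\dots,a_{k+1})$ of elements of $A$ with $(a_i,a_{i+1})\in R$ for $i=1,\dots,k$ and $a_1=a_{k+1}$ (vertices may repeat); it is odd if $k$ is odd. *)

(* Defs.v *)
From mathcomp Require Import all_boot.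
From Corelib Require Export RelationClasses.

Set Implicit Arguments.
Unset Strict Implicit.
Unset Printing Implicit Defensive.

(* [A] may be infinite, with no decidable equality, so a binary relation on it
   is Prop-valued: [A -> A -> Prop]. *)

Definition operation (n : nat) (A : Type) : Type := n.-tuple A -> A.

Definition near_unanimity (A : Type) (n : nat) (f : operation n A) : Prop :=
  2 < n /\
  forall (x y : A) (i : 'I_n), f [tuple if j == i then y else x | j < n] = x.

Definition compatible (A : Type) (n : nat) (f : operation n A)
    (R : A -> A -> Prop) : Prop :=
  forall s t : n.-tuple A,
    (forall i : 'I_n, R (tnth s i) (tnth t i)) -> R (f s) (f t).

(* Indices are shifted by one: the (i+1)-st vertex is [tnth a] at value [i],
   and [lift ord0 i] has value [i.+1]. *)
Definition is_cycle (A : Type) (R : A -> A -> Prop) (k : nat)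
    (a : k.+1.-tuple A) : Prop :=
  (forall i : 'I_k,
     R (tnth a (widen_ord (leqnSn k) i)) (tnth a (lift ord0 i))) /\
  tnth a ord0 = tnth a ord_max.

Definition has_odd_cycle (A : Type) (R : A -> A -> Prop) : Prop :=
  exists (k : nat) (a : k.+1.-tuple A), odd k /\ is_cycle R a.

(* Main.v *)
Require Import Defs.
From mathcomp Require Import all_boot zify.
From Stdlib Require Import Classical.

(** For a symmetric relation [Q] compatible with an [n]-ary near unanimity
    operation [f], a clique [c_1, .., c_n] yields a loop at [z = f(c_1, .., c_n)]:
    first [z] is adjacent to each [c_i], whence [f(z, .., z)] is adjacent to
    [f(c_1, .., c_n)].  If [Q] has odd girth [k >= 3], the vertices of a shortest
    odd cycle form a [k]-clique of [S = Q^(k-2)], and a loop of [S] would be a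
    shorter odd closed walk; hence [k < n].  The [S]-neighbourhood [N] of a vertex
    [a] on a shortest odd cycle is absorbing, so applying [f] to [n] shifted copies
    of a long closed walk that visits [a] only once gives an odd closed walk inside
    [N].  The odd girth of [Q] restricted to [N] is at least [k], and, being bounded
    by [n], one may assume by downward induction that it is exactly [k].  Iterating
    inside [N] then produces arbitrarily large [S]-cliques, a contradiction. *)

Set Implicit Arguments.
Unset Strict Implicit.
Unset Printing Implicit Defensive.

(** * Walks and odd girth *)

Section Walks.

Variable A : Type.
Implicit Types (Q : A -> A -> Prop) (x y z : A) (v : nat -> A).

(** A total function on [nat] carries the vertices, so that cutting, gluing and reversing are index
    arithmetic. *)
Definition walk Q (k : nat) x y : Prop :=
  exists v, [/\ v 0 = x, v k = y & forall i, i < k -> Q (v i) (v i.+1)].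

Lemma walk_edge Q x y : Q x y -> walk Q 1 x y.
Proof. by move=> Qxy; exists (fun i => if i == 0 then x else y); split=> // -[]. Qed.

Lemma walk_segment Q v k i j :
  (forall t, t < k -> Q (v t) (v t.+1)) -> i <= j <= k ->
  walk Q (j - i) (v i) (v j).
Proof.
move=> Qv ijk; exists (fun t => v (i + t)); split=> [||t lt_t].
- by rewrite addn0.
- by congr v; lia.
- by rewrite addnS; apply: Qv; lia.
Qed.

Lemma walk_cat Q k l x y z : walk Q k x y -> walk Q l y z -> walk Q (k + l) x z.
Proof.
move=> [u [u0 uk Qu]] [v [v0 vl Qv]].
exists (fun t => if t < k then u t else v (t - k)); split=> [||t lt_t].
- by case: k uk {Qu} => [|k] uk; rewrite //= v0 -uk.
- by rewrite ltnNge leq_addr /= addKn.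
- case: (ltngtP t.+1 k) => [lt_tk|lt_kt|eq_tk].
  + by apply: Qu; lia.
  + by rewrite subSn //; apply: Qv; lia.
  + by rewrite eq_tk subnn v0 -uk -eq_tk; apply: Qu; lia.
Qed.

Lemma walk_sym Q k x y : Symmetric Q -> walk Q k x y -> walk Q k y x.
Proof.
move=> Qsym [v [v0 vk Qv]]; exists (fun t => v (k - t)); split=> [||t lt_t].
- by rewrite subn0.
- by rewrite subnn.
- by apply: Qsym; rewrite (_ : k - t = (k - t.+1).+1); [apply: Qv|]; lia.
Qed.

Lemma walk_start Q k x y : 0 < k -> walk Q k x y -> exists z, Q x z.
Proof. by move=> k0 [v [<- _ Qv]]; exists (v 1); apply: Qv. Qed.

Lemma walk_pad Q k m x y : Symmetric Q -> 0 < k -> walk Q k x y ->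
  walk Q (k + m.*2) x y.
Proof.
move=> Qsym k0 Wxy; have [z Qxz] := walk_start k0 Wxy.
elim: m => [|m IHm]; first by rewrite addn0.
have Wxx : walk Q 2 x x.
  exact: (walk_cat (walk_edge Qxz) (walk_edge (Qsym _ _ Qxz))).
by have := walk_cat Wxx IHm; congr (walk Q _ x y); lia.
Qed.

Lemma walk_mono Q Q' k x y : (forall x y, Q x y -> Q' x y) ->
  walk Q k x y -> walk Q' k x y.
Proof. by move=> QQ' [v [v0 vk Qv]]; exists v; split=> // i /Qv /QQ'. Qed.

Definition odd_closed_walk Q (k : nat) : Prop :=
  odd k /\ exists x, walk Q k x x.

Definition odd_girth Q (k : nat) : Prop :=
  odd_closed_walk Q k /\ forall j, j < k -> ~ odd_closed_walk Q j.

Lemma odd_girth_exists Q k : odd_closed_walk Q k -> exists g, odd_girth Q g.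
Proof.
elim/ltn_ind: k => k IHk Wk.
have [[j [lt_jk Wj]]|no_j] :=
  classic (exists j, j < k /\ odd_closed_walk Q j); first exact: IHk Wj.
by exists k; split=> // j lt_jk Wj; apply: no_j; exists j.
Qed.

(** * Chords of odd cycles *)

Section Chords.

Variables (Q : A -> A -> Prop) (k : nat) (v : nat -> A).
Hypotheses (Qsym : Symmetric Q) (k_odd : odd k) (v_closed : v 0 = v k).
Hypothesis Qv : forall t, t < k -> Q (v t) (v t.+1).

(* Of the two arcs joining two vertices of the cycle one has odd length, at most
   [k - 2]; it is padded by going back and forth along an edge. *)
Lemma cycle_chord i j : i < j < k -> walk Q (k - 2) (v i) (v j).
Proof.
move=> ijk; case: (boolP (odd (j - i))) => odd_ji.
- have W : walk Q (j - i) (v i) (v j) by apply: (walk_segment Qv); lia.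
  have := walk_pad ((k - 2 - (j - i))./2) Qsym _ W.
  by rewrite (_ : j - i + _ = k - 2); [apply; lia | lia].
- have W1 : walk Q (i - 0) (v 0) (v i) by apply: (walk_segment Qv); lia.
  have W2 : walk Q (k - j) (v j) (v k) by apply: (walk_segment Qv); lia.
  rewrite v_closed in W1; have W := walk_sym Qsym (walk_cat W2 W1).
  have := walk_pad ((k - 2 - (k - j + (i - 0)))./2) Qsym _ W.
  by rewrite (_ : k - j + _ + _ = k - 2); [apply; lia | lia].
Qed.

Lemma cycle_clique i j : i < k -> j < k -> i != j -> walk Q (k - 2) (v i) (v j).
Proof.
move=> lt_ik lt_jk; case: (ltngtP i j) => // ltij _.
- by apply: cycle_chord; rewrite ltij.
- by apply: (walk_sym Qsym); apply: cycle_chord; rewrite ltij.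
Qed.

End Chords.

End Walks.

(** * Compatible relations and absorption *)

Section NearUnanimity.

Variables (A : Type) (n : nat) (f : operation n A).
Hypothesis f_nu : near_unanimity f.
Implicit Types (Q S : A -> A -> Prop) (c s : 'I_n -> A).

Notation app c := (f [tuple c i | i < n]).

Lemma near_unanimityE x s (i : 'I_n) :
  (forall j, j != i -> s j = x) -> app s = x.
Proof.
have [_ fE] := f_nu => sx; rewrite -[RHS](fE x (s i) i).
congr f; apply: eq_mktuple => j.
by case: eqVneq => [->|/sx].
Qed.

Lemma app_const x : app (fun=> x) = x.
Proof.
have n0 : 0 < n by have [/ltnW/ltnW] := f_nu.
exact: (@near_unanimityE _ _ (Ordinal n0)).
Qed.

Lemma compatible_app Q s c : compatible f Q ->
  (forall i, Q (s i) (c i)) -> Q (app s) (app c).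
Proof. by move=> Qf Qsc; apply: Qf => i; rewrite !tnth_mktuple. Qed.

Lemma walk_compatible Q k : compatible f Q -> compatible f (walk Q k).
Proof.
move=> Qf s t /fin_all_exists[v vP]; exists (fun m => app (v^~ m)).
split=> [||m lt_m].
- by congr f; apply: eq_from_tnth => i; rewrite tnth_mktuple; case: (vP i).
- by congr f; apply: eq_from_tnth => i; rewrite tnth_mktuple; case: (vP i).
- by apply: compatible_app => // i; case: (vP i) => _ _; apply.
Qed.

(** Near unanimity writes [a] as [f(a, .., y, .., a)] with [y] at position [i0], a tuple related to
    [s] entry by entry. *)
Lemma neighbourhood_absorbs S a s (i0 : 'I_n) : compatible f S ->
  (exists y, S y (s i0)) -> (forall i, i != i0 -> S a (s i)) -> S a (app s).
Proof.
move=> Sf [y Sy] Sa.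
rewrite -[a](@near_unanimityE _ (fun i => if i == i0 then y else a) i0).
  by apply: compatible_app => // i; case: eqVneq => [->|/Sa].
by move=> j /negPf ->.
Qed.

Lemma clique_loop S c : Symmetric S -> compatible f S ->
  (forall i j, i != j -> S (c i) (c j)) -> exists z, S z z.
Proof.
move=> Ssym Sf Sc; exists (app c).
have Scz i : S (c i) (app c).
  have [j ji] : exists j : 'I_n, j != i.
    have n1 : 1 < n by case: f_nu => /ltnW.
    case: (eqVneq i (Ordinal n1)) => [->|]; last by exists (Ordinal n1); rewrite eq_sym.
    by exists (Ordinal (ltnW n1)).
  (* Only the entry [c i] may fail to be adjacent to [c i]; it sits at the absorbed position and has
     the neighbour [c j]. *)
  apply: (@neighbourhood_absorbs S _ c i) => // [|l li].
  - by exists (c j); apply: Sc.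
  - by apply: Sc; rewrite eq_sym.
rewrite -{1}[app c]app_const; apply: compatible_app => // i.
exact: Ssym.
Qed.

Definition restrict Q (N : A -> Prop) x y : Prop := [/\ Q x y, N x & N y].

Lemma restrict_sym Q N : Symmetric Q -> Symmetric (restrict Q N).
Proof. by move=> Qsym x y [/Qsym]. Qed.

(** The set [S a] is closed under [f] because [a = f(a, .., a)]. *)
Lemma restrict_neighbourhood_compatible Q S a :
  compatible f Q -> compatible f S -> compatible f (restrict Q (S a)).
Proof.
move=> Qf Sf s t st.
by split; [|rewrite -[a]app_const..]; (apply: Qf || apply: Sf) => i;
  rewrite ?tnth_mktuple; case: (st i).
Qed.

(** * An odd closed walk inside a neighbourhood *)

Section Girth.

Variables (Q : A -> A -> Prop) (k : nat) (v : nat -> A).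
Hypotheses (Qsym : Symmetric Q) (Qf : compatible f Q).
Hypotheses (k_odd : odd k) (k_gt1 : 1 < k) (v_closed : v 0 = v k).
Hypothesis Qv : forall t, t < k -> Q (v t) (v t.+1).

(* The closed walk followed by each argument of [f]: once around the cycle, then
   [n] times back and forth along its last edge before returning to [v 0]. *)
Let L := k + n.*2.
Let vertex t := if t < k then t else if odd (t - k) then k - 1 else k - 2.

Let detour t := v (vertex (t %% L)).

Let detour_edge t : Q (detour t) (detour t.+1).
Proof.
have L0 : 0 < L by rewrite /L; lia.
have ltL := ltn_pmod t L0.
(* At time [L - 1] the detour is at [v (k - 1)], as [L - 1 - k] is odd; the next edge closes the
   cycle. *)
have [eqL|neqL] := eqVneq (t %% L).+1 L.
  have tS0 : t.+1 %% L = 0 by rewrite -addn1 -modnDml addn1 eqL modnn.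
  have -> : detour t.+1 = v k by rewrite /detour tS0 /vertex ifT //; lia.
  have -> : detour t = v k.-1.
    rewrite /detour /vertex; move: (t %% L) eqL => r; rewrite /L => eqL; congr v.
    by case: ifP => ?; [|case: ifP]; lia.
  by rewrite -{2}(ltn_predK k_gt1); apply: Qv; lia.
have tS : t.+1 %% L = (t %% L).+1.
  by rewrite -addn1 -modnDml addn1 modn_small //; lia.
rewrite /detour tS /vertex; move: (t %% L) => r.
case: (ltngtP r.+1 k) => [lt_rk|lt_kr|eq_rk].
- by apply: Qv; lia.
- rewrite subSn //.
  have Qe : Q (v (k - 2)) (v (k - 1)).
    by rewrite (_ : k - 1 = (k - 2).+1); [apply: Qv|]; lia.
  by rewrite /=; case: (odd _) => //=; apply: Qsym.
- rewrite eq_rk subnn /= (_ : r = (k - 2).+1); last lia.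
  by apply: Qsym; apply: Qv; lia.
Qed.

Lemma neighbourhood_odd_closed_walk :
  odd_closed_walk (restrict Q (walk Q (k - 2) (v 0))) L.
Proof.
split; first by rewrite /L oddD odd_double addbF.
pose z t := app (fun i : 'I_n => detour (t + i)).
exists (z 0); exists z; split=> // [|t lt_t].
  by congr f; apply: eq_mktuple => i; rewrite /detour modnDl.
have L0 : 0 < L by rewrite /L; lia.
have Nz m : walk Q (k - 2) (v 0) (z m).
  (* The shifts are less than [n < L], so at most one copy is at time 0 modulo [L], the only time
     with index 0. *)
  have [i0 i0P] : exists i0 : 'I_n, forall i, i != i0 -> (m + i) %% L != 0.
    have n0 : 0 < n by have [/ltnW/ltnW] := f_nu.
    case: (pickP (fun i : 'I_n => (m + i) %% L == 0)) => [i /eqP mi0|none].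
    - exists i => j; apply: contraNneq => mj0; apply/eqP/val_inj/eqP => /=.
      have lti := ltn_ord i; have ltj := ltn_ord j.
      have /eqP : m + j = m + i %[mod L] by rewrite mi0 mj0.
      by rewrite eqn_modDl !modn_small // /L; lia.
    - by exists (Ordinal n0) => i _; rewrite none.
  apply: (@neighbourhood_absorbs _ _ _ i0); first exact: walk_compatible.
  (* The absorbed entry needs only some walk of length [k - 2] ending there: its next edge,
     padded. *)
  - exists (detour (m + i0).+1); apply: walk_sym => //.
    have := walk_pad ((k - 3)./2) Qsym _ (walk_edge (detour_edge (m + i0))).
    by rewrite (_ : 1 + _ = k - 2); [apply | lia].
  - move=> i /i0P; rewrite -lt0n => gt0.
    apply: (cycle_chord Qsym k_odd v_closed Qv).
    by rewrite /vertex; do 2?case: ifP; lia.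
by split=> //; apply: compatible_app => // i; rewrite addSn.
Qed.

End Girth.

(** * Excluding odd girth above 1 *)

Lemma odd_girth_clique_free Q k (c : nat -> A) :
  Symmetric Q -> compatible f Q -> odd_girth Q k -> 1 < k ->
  ~ (forall i j, i < n -> j < n -> i != j -> walk Q (k - 2) (c i) (c j)).
Proof.
move=> Qsym Qf [[k_odd _] k_min] k_gt1 Wc.
have [z Wz] : exists z, walk Q (k - 2) z z.
  apply: (@clique_loop _ (fun i => c i)) => [x y||].
  - exact: walk_sym.
  - exact: walk_compatible.
  - by move=> i j ij; apply: Wc.
by apply: (k_min (k - 2)); [lia | split; [lia | exists z]].
Qed.

(* The existence of an edge at each [c i] matters only when [m = 1]: it puts [c i]
   in the neighbourhood to which the relation has been restricted. *)
Lemma odd_girth_clique k m Q : 1 < k ->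
  (forall Q' k', Symmetric Q' -> compatible f Q' -> k < k' ->
     ~ odd_girth Q' k') ->
  Symmetric Q -> compatible f Q -> odd_girth Q k ->
  exists c : nat -> A,
    (forall i, i < m -> exists y, Q (c i) y) /\
    (forall i j, i < m -> j < m -> i != j -> walk Q (k - 2) (c i) (c j)).
Proof.
move=> k_gt1 no_larger; elim: m Q => [|m IHm] Q Qsym Qf girthQ;
  have [[k_odd [x [v [v0 vk Qv]]]] k_min] := girthQ.
  by exists v.
have v_closed : v 0 = v k by rewrite v0.
pose N := walk Q (k - 2) (v 0); pose Q' := restrict Q N.
have Q'Q x' y' : Q' x' y' -> Q x' y' by case.
have Q'sym : Symmetric Q' by apply: restrict_sym.
have Q'f : compatible f Q'.
  by apply: restrict_neighbourhood_compatible => //; apply: walk_compatible.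
have [g girthQ'] : exists g, odd_girth Q' g.
  apply: odd_girth_exists.
  exact: (neighbourhood_odd_closed_walk Qsym Qf k_odd k_gt1 v_closed Qv).
have eq_gk : g = k.
  case: (ltngtP g k) => // [lt_gk|lt_kg].
  - case: girthQ' => [[g_odd [y Wy]] _]; case: (k_min g lt_gk).
    by split=> //; exists y; apply: walk_mono Wy.
  - by case: (no_larger Q' g).
have [c [edge_c Wc]] := IHm Q' Q'sym Q'f (eq_ind _ _ girthQ' _ eq_gk).
have Nc i : i < m -> N (c i) by move=> /edge_c[y []].
(* The clique for [Q'] lies in [N], hence [v 0] extends it. *)
exists (fun i => if i is i'.+1 then c i' else v 0); split.
- case=> [_|i /edge_c[y /Q'Q Qy]]; last by exists y.
  by exists (v 1); apply: Qv; lia.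
- case=> [|i] [|j] //= lt_i lt_j ij.
  + exact: Nc.
  + by apply: walk_sym => //; apply: Nc.
  + exact: walk_mono Q'Q (Wc i j lt_i lt_j ij).
Qed.

Lemma odd_girth_le1 Q k : Symmetric Q -> compatible f Q -> 1 < k ->
  ~ odd_girth Q k.
Proof.
move: {2}(n - k) (leqnn (n - k)) => d; elim: d k Q => [|d IHd] k Q le_d Qsym Qf k_gt1 girthQ.
(* Here [n <= k], and the first [n] vertices of a shortest cycle already form the forbidden
   clique. *)
- have [[k_odd [x [v [v0 vk Qv]]]] _] := girthQ.
  apply: (odd_girth_clique_free Qsym Qf girthQ k_gt1 (c := v)) => i j lt_i lt_j.
  by apply: cycle_clique => //; [rewrite v0 | lia | lia].
- have [|c [_]] := @odd_girth_clique k n Q k_gt1 _ Qsym Qf girthQ.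
  + by move=> Q' k' Q'sym Q'f lt_k; apply: IHd => //; lia.
  + exact: odd_girth_clique_free.
Qed.

Lemma odd_closed_walk_loop Q k : Symmetric Q -> compatible f Q ->
  odd_closed_walk Q k -> exists a, Q a a.
Proof.
move=> Qsym Qf /odd_girth_exists[g girthQ].
case: (ltnP 1 g) => [gt_g1|le_g1]; first by case: (odd_girth_le1 Qsym Qf gt_g1).
have [[g_odd [x [v [v0 vg Qv]]]] _] := girthQ.
have eq_g1 : g = 1 by lia.
by exists x; rewrite -{1}v0 -vg eq_g1; apply: Qv; rewrite eq_g1.
Qed.

End NearUnanimity.

Lemma has_odd_cycle_closed_walk (A : Type) (R : A -> A -> Prop) :
  has_odd_cycle R -> exists k, odd_closed_walk R k.
Proof.
move=> [k [a [k_odd [Ra a_closed]]]]; exists k; split=> //.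
exists (tnth a ord0), (fun i => tnth a (inord i)); split.
- by congr tnth; apply: val_inj; rewrite /= inordK.
- by rewrite a_closed; congr tnth; apply: val_inj; rewrite /= inordK.
- move=> i lt_i; have := Ra (Ordinal lt_i).
  by congr (R (tnth a _) (tnth a _)); apply: val_inj; rewrite /= inordK //; lia.
Qed.

Theorem corollary4p6 (A : Type) (R : A -> A -> Prop)
    (R_sym : Symmetric R)
    (R_odd : has_odd_cycle R)
    (R_nu : exists (n : nat) (f : operation n A),
        near_unanimity f /\ compatible f R) :
  exists a : A, R a a.
Proof.
have [n [f [f_nu Rf]]] := R_nu.
have [k Wk] := has_odd_cycle_closed_walk R_odd.
exact: (odd_closed_walk_loop f_nu R_sym Rf Wk).
Qed.
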